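(* For $n$ agents, $p$ items, an arbitrary scoring utility function $g$ and a given policy $\pi\in\{1,\ldots,n\}^p$, the expected utility $\overline{u_i}(\pi)$ of each agent $i$, as well as the expected utilitarian social welfare $\overline{\mathrm{sw}}(\pi)$, can be computed in polynomial time.
   Context: There are $p$ indivisible items and $n$ agents. Each agent has a strict total preference order over the items; a profile $R$ is an $n$-tuple of such orders. All agents share the same utility function $g$: an item in $k$-th position of an agent's order ($k=1$ is most preferred) has utility $g(k)$ for that agent. The utility of a set of items is the sum of the individual utilities. The preference orders of the agents are independent and each is uniformly distributed over all $p!$ orders. A policy is a sequence $\pi=\pi_1\ldots\pi_p\in\{1,\ldots,n\}^p$; at step $k$ agent $\pi_k$ picks one of the remaining items, namely the one she ranks highest among the remaining items. $u_R(i,\pi)$ is the total utility obtained by agent $i$ for profile $R$, $\overline{u_i}(\pi)$ is the expectation of $u_R(i,\pi)$ over random profiles, and $\overline{\mathrm{sw}}(\pi)=\sum_{i=1}^n\overline{u_i}(\pi)$. The input consists of $n$, $p$, the policy $\pi$ and the values $g(1),\ldots,g(p)$; polynomial means polynomial in $n$ and $p$, counting arithmetic operations. *)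

(* Defs.v *)
From mathcomp Require Import all_boot all_order all_fingroup all_algebra.

Set Implicit Arguments.
Unset Strict Implicit.
Unset Printing Implicit Defensive.

Import GRing.Theory Num.Theory.
Local Open Scope ring_scope.

Section PickingSequences.

Variables (F : realFieldType) (n p : nat).

(* A strict total order on the p items is given by its rank function, a
   permutation r : r o is the position of the item o. Positions and agents are
   counted from 0, so r o = 0 means that o is the most preferred item. *)
Definition preference := {perm 'I_p}.

Definition profile := {ffun 'I_n -> preference}.

Definition favourite (r : preference) (S : {set 'I_p}) : option 'I_p :=
  [pick o in S | [forall o' in S, (r o <= r o')%N]].

(* The items that agent i obtains when S is the set of remaining items and
   pi is the sequence of agents that are still to pick. *)
Fixpoint bundle (R : profile) (i : 'I_n) (pi : seq 'I_n) (S : {set 'I_p}) :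
    {set 'I_p} :=
  if pi is j :: pi' then
    if favourite (R j) S is Some o then
      let B := bundle R i pi' (S :\ o) in if j == i then o |: B else B
    else set0
  else set0.

Definition utility (g : 'I_p -> F) (R : profile) (i : 'I_n)
    (pi : p.-tuple 'I_n) : F :=
  \sum_(o in bundle R i pi [set: 'I_p]) g (R i o).

(* Independent preferences, each uniform over the p! orders. *)
Definition profile_prob (R : profile) : F := \prod_(i < n) (p`!%:R)^-1.

Definition expected_utility (g : 'I_p -> F) (i : 'I_n) (pi : p.-tuple 'I_n) :
    F :=
  \sum_(R : profile) profile_prob R * utility g R i pi.

Definition expected_social_welfare (g : 'I_p -> F) (pi : p.-tuple 'I_n) : F :=
  \sum_(i < n) expected_utility g i pi.

End PickingSequences.

(* Uniform model of computation: an arithmetic random access machine, with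
   integer registers and arrays (for indices and control) and with registers
   and arrays that contain elements of an ordered field. The syntax does not
   mention the field, and it contains no field constant. Registers, arrays and
   the cells of an array are numbered by natural numbers, and a program only
   names finitely many registers and arrays. There is no integer
   multiplication: one operation at most doubles the largest integer in memory,
   up to the constants of the program. *)
Inductive instr : Type :=
  | NConst of nat & nat         (* NConst x k     x := k *)
  | NAdd of nat & nat & nat     (* NAdd x y z     x := y + z *)
  | NSub of nat & nat & nat     (* NSub x y z     x := y - z, truncated *)
  | NLoad of nat & nat & nat    (* NLoad x a y    x := a[y] *)
  | NStore of nat & nat & nat   (* NStore a y x   a[y] := x *)
  | FOfNat of nat & nat         (* FOfNat u x     u := x, integer to field *)
  | FAdd of nat & nat & nat     (* FAdd u v w     u := v + w *)
  | FSub of nat & nat & nat     (* FSub u v w     u := v - w *)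
  | FMul of nat & nat & nat     (* FMul u v w     u := v * w *)
  | FDiv of nat & nat & nat     (* FDiv u v w     u := v / w *)
  | FLoad of nat & nat & nat    (* FLoad u a y    u := a[y] *)
  | FStore of nat & nat & nat.  (* FStore a y u   a[y] := u *)

Inductive test : Type :=
  | NEq of nat & nat
  | NLt of nat & nat
  | FEq of nat & nat
  | FLt of nat & nat.

Inductive prog : Type :=
  | Skip
  | Instr of instr
  | Seq of prog & prog
  | If of test & prog & prog
  | While of test & prog.

Definition upd (T : Type) (f : nat -> T) (x : nat) (v : T) : nat -> T :=
  fun y => if y == x then v else f y.

Definition upd2 (T : Type) (f : nat -> nat -> T) (a k : nat) (v : T) :
    nat -> nat -> T :=
  upd f a (upd (f a) k v).

Section Machine.

Variable F : realFieldType.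

Record state : Type := State {
  nreg : nat -> nat;
  narr : nat -> nat -> nat;
  freg : nat -> F;
  farr : nat -> nat -> F
}.

Definition set_nreg (s : state) (x k : nat) : state :=
  State (upd (nreg s) x k) (narr s) (freg s) (farr s).

Definition set_narr (s : state) (a j k : nat) : state :=
  State (nreg s) (upd2 (narr s) a j k) (freg s) (farr s).

Definition set_freg (s : state) (u : nat) (c : F) : state :=
  State (nreg s) (narr s) (upd (freg s) u c) (farr s).

Definition set_farr (s : state) (a j : nat) (c : F) : state :=
  State (nreg s) (narr s) (freg s) (upd2 (farr s) a j c).

Definition step (c : instr) (s : state) : state :=
  match c with
  | NConst x k => set_nreg s x k
  | NAdd x y z => set_nreg s x (nreg s y + nreg s z)%N
  | NSub x y z => set_nreg s x (nreg s y - nreg s z)%N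
  | NLoad x a y => set_nreg s x (narr s a (nreg s y))
  | NStore a y x => set_narr s a (nreg s y) (nreg s x)
  | FOfNat u x => set_freg s u (nreg s x)%:R
  | FAdd u v w => set_freg s u (freg s v + freg s w)
  | FSub u v w => set_freg s u (freg s v - freg s w)
  | FMul u v w => set_freg s u (freg s v * freg s w)
  | FDiv u v w => set_freg s u (freg s v / freg s w)
  | FLoad u a y => set_freg s u (farr s a (nreg s y))
  | FStore a y u => set_farr s a (nreg s y) (freg s u)
  end.

Definition eval_test (b : test) (s : state) : bool :=
  match b with
  | NEq x y => nreg s x == nreg s y
  | NLt x y => (nreg s x < nreg s y)%N
  | FEq u v => freg s u == freg s v
  | FLt u v => freg s u < freg s v
  end.

(* exec c s t s': started in s, the program c halts in s' after t operations.
   Every instruction (not only the field operations) and every evaluation of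
   a test counts as one operation. *)
Inductive exec : prog -> state -> nat -> state -> Prop :=
  | ExecSkip s : exec Skip s 0 s
  | ExecInstr c s : exec (Instr c) s 1 (step c s)
  | ExecSeq c1 c2 s1 t1 s2 t2 s3 :
      exec c1 s1 t1 s2 -> exec c2 s2 t2 s3 -> exec (Seq c1 c2) s1 (t1 + t2) s3
  | ExecIfTrue b c1 c2 s t s' :
      eval_test b s -> exec c1 s t s' -> exec (If b c1 c2) s t.+1 s'
  | ExecIfFalse b c1 c2 s t s' :
      ~~ eval_test b s -> exec c2 s t s' -> exec (If b c1 c2) s t.+1 s'
  | ExecWhileTrue b c s1 t1 s2 t2 s3 :
      eval_test b s1 -> exec c s1 t1 s2 -> exec (While b c) s2 t2 s3 ->
      exec (While b c) s1 (t1 + t2).+1 s3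
  | ExecWhileFalse b c s :
      ~~ eval_test b s -> exec (While b c) s 1 s.

(* Integer registers 0 and 1 contain n and p, integer array 0 contains the
   policy and field array 0 contains the values of g; everything else is 0. *)
Definition input_state (n p : nat) (pi : p.-tuple 'I_n) (g : 'I_p -> F) :
    state :=
  State
    (nth 0%N [:: n; p])
    (nth (fun=> 0%N) [:: nth 0%N [seq val j | j <- pi]])
    (fun=> 0)
    (nth (fun=> 0) [:: nth 0 [seq g k | k <- enum 'I_p]]).

End Machine.

(* Main.v *)
(* Fix agent [i]. Relabelling the items, we may assume that her preference is the
   identity. When another agent picks, the item is uniform among the remaining
   items and independent of the order in which that agent ranks the other
   remaining items. Hence, if [i] has already examined the positions before
   [p - m], the [k] remaining items are a uniformly random [k]-subset of the
   last [m] positions. Such a subset contains the position [p - m] with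
   probability [k / m], which gives a recursion for the expected utility with
   states [(k, m)]; a program tabulates it in time O(p^2) per agent. *)
Require Import Defs.
From mathcomp Require Import all_boot all_order all_fingroup all_algebra.
From mathcomp Require Import zify ring.

Import GRing.Theory Num.Theory.
Local Open Scope ring_scope.
Set Implicit Arguments.
Unset Strict Implicit.
Unset Printing Implicit Defensive.

(** * Picking under restriction and relabelling of the items *)

Section Bundle.
Variables (n p : nat).
Implicit Types (r s : preference p) (R : profile n p) (S T : {set 'I_p}).

Lemma favourite_Some r S o :
  favourite r S = Some o <-> o \in S /\ {in S, forall x, (r o <= r x)%N}.
Proof.
rewrite /favourite; case: pickP => [x /andP[xS /forall_inP min_x]|none].
  split=> [[<-] //|[oS min_o]]; congr Some; apply: (@perm_inj _ r).
  by apply/val_inj/eqP; rewrite eqn_leq min_x //= min_o.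
split=> // -[oS min_o]; case/negP: (negbT (none o)).
by rewrite oS; apply/forall_inP.
Qed.

Lemma favourite_exists r S x : x \in S -> exists o, favourite r S = Some o.
Proof.
move=> xS; have [o oS min_o] := arg_minnP (fun y => r y : nat) xS.
by exists o; apply/favourite_Some; split=> // y /min_o.
Qed.

Lemma favourite_None r S : favourite r S = None -> S = set0.
Proof.
move=> fav; apply/eqP/set0Pn => -[x xS].
by have [o] := favourite_exists r xS; rewrite fav.
Qed.

Lemma favourite_order r r' S :
  {in S &, forall x y, (r x <= r y)%N = (r' x <= r' y)%N} ->
  favourite r S = favourite r' S.
Proof.
move=> eq_rr'; case fav: (favourite r' S) => [o|]; last first.
  case fav': (favourite r S) => [o|] //.
  by move/favourite_Some: fav' => []; rewrite (favourite_None fav) inE.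
have [oS min_o] := (favourite_Some _ _ _).1 fav.
by apply/favourite_Some; split=> // x xS; rewrite eq_rr' // min_o.
Qed.

Lemma favourite_relabel s r S :
  favourite r (s @: S) = omap s (favourite (s * r)%g S).
Proof.
case fav: (favourite _ S) => [o|] /=; last first.
  rewrite (favourite_None fav) imset0.
  by case fav': favourite => [o|] //; move/favourite_Some: fav'; rewrite inE => -[].
have [oS min_o] := (favourite_Some _ _ _).1 fav.
apply/favourite_Some; split=> [|_ /imsetP[x xS ->]]; first exact: imset_f.
by have := min_o x xS; rewrite !permM.
Qed.

Lemma bundle_sub R i pi S : bundle R i pi S \subset S.
Proof.
elim: pi S => [|j pi IH] S /=; first exact: sub0set.
case fav: favourite => [o|]; last exact: sub0set.
have [oS _] := (favourite_Some _ _ _).1 fav.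
have sub := subset_trans (IH (S :\ o)) (subsetDl _ _).
by case: eqP => // _; rewrite subUset sub1set oS.
Qed.

(** Picking only ever compares items that remain. Hence what happens after a pick ignores where the
    picked item stood in anybody's order. *)
Lemma bundle_order R R' i pi S :
  (forall j, {in S &, forall x y, (R j x <= R j y)%N = (R' j x <= R' j y)%N}) ->
  bundle R i pi S = bundle R' i pi S.
Proof.
elim: pi S => [|j pi IH] S eq_RR' //=.
rewrite (favourite_order (eq_RR' j)); case: favourite => // o.
by rewrite (IH (S :\ o)) // => k x y /setD1P[_ xS] /setD1P[_ yS]; apply: eq_RR'.
Qed.

(** Permutations compose from left to right: item [x] now has the ranks that [s x] has in [R]. *)
Definition relabel s R : profile n p := [ffun j => (s * R j)%g].

Lemma bundle_relabel s R i pi S :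
  s @: bundle (relabel s R) i pi S = bundle R i pi (s @: S).
Proof.
elim: pi S => [|j pi IH] S /=; first exact: imset0.
rewrite favourite_relabel ffunE; case: favourite => [o|] /=; last exact: imset0.
have -> : s @: S :\ s o = s @: (S :\ o).
  apply/setP => x; rewrite -[x](permKV s) !inE.
  by rewrite !(mem_imset _ _ perm_inj) !inE (inj_eq perm_inj).
by case: eqP => _; rewrite -IH // imsetU1.
Qed.

Lemma bundle_cons R i j pi S o : favourite (R j) S = Some o ->
  bundle R i (j :: pi) S =
  if j == i then o |: bundle R i pi (S :\ o) else bundle R i pi (S :\ o).
Proof. by move=> /= ->. Qed.

End Bundle.

(** * Uniformity and independence of a pick *)

Section FavouriteUniform.
Variables (V : nmodType) (n p : nat) (j : 'I_n) (S : {set 'I_p}) (o : 'I_p).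
Variable h : profile n p -> V.
Hypothesis oS : o \in S.
Hypothesis h_order : forall R R' : profile n p,
  (forall k, k != j -> R k = R' k) ->
  {in S :\ o &, forall x y, (R j x <= R j y)%N = (R' j x <= R' j y)%N} ->
  h R = h R'.

Let N (T : {set 'I_p}) v := \sum_(R : profile n p | (R j @: S == T) && (R j o == v)) h R.

Let swap v w (R : profile n p) : profile n p :=
  [ffun k => if k == j then (R j * tperm v w)%g else R k].

Let swapK v w : involutive (swap v w).
Proof.
move=> R; apply/ffunP => k; rewrite !ffunE eqxx.
by case: eqP => // ->; rewrite -mulgA tperm2 mulg1.
Qed.

Let swap_image v w (T : {set 'I_p}) R : v \in T -> w \in T ->
  (swap v w R j @: S == T) = (R j @: S == T).
Proof.
move=> vT wT; have tT : tperm v w @: T = T.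
  apply/setP => x; apply/imsetP/idP => [[y yT ->]|xT].
    by case: tpermP.
  by exists (tperm v w x); rewrite ?tpermK //; case: tpermP.
rewrite ffunE eqxx.
have -> : (R j * tperm v w)%g @: S = tperm v w @: (R j @: S).
  by rewrite -imset_comp; apply: eq_imset => x; rewrite /= permM.
by rewrite -{1}tT (inj_eq (imset_inj perm_inj)).
Qed.

(* Exchanging the item [o] with its neighbour among the items of [S] does not
   change the order of [S :\ o]. *)
Let N_swap (T : {set 'I_p}) v w : v \in T -> w \in T -> (w < v)%N ->
  {in T, forall u : 'I_p, ~~ (w < u < v)%N} -> N T v = N T w.
Proof.
move=> vT wT lt_wv adj; rewrite /N (reindex_inj (inv_inj (swapK v w))).
have eqP0 R : (swap v w R j @: S == T) && (swap v w R j o == v)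
   = (R j @: S == T) && (R j o == w).
  rewrite swap_image // ffunE eqxx permM; congr (_ && _).
  by rewrite (can2_eq (tpermK v w) (tpermK v w)) tpermL.
apply: eq_big => [R|R]; first exact: eqP0.
rewrite eqP0 => /andP[/eqP RS /eqP Ro].
apply: h_order => [k /negPf kj|x y /setD1P[xo xS] /setD1P[yo yS]].
  by rewrite ffunE kj.
rewrite !ffunE eqxx !permM.
(* An item of [S] at position [v] drops to [w], and the items in the way would have to lie at [w] or
   strictly between; only [o] does. *)
have key z : z \in S -> z != o -> R j z != w /\ ~~ (w < R j z < v)%N.
  move=> zS zo; rewrite -Ro (inj_eq perm_inj) zo; split=> //.
  by rewrite Ro adj // -RS imset_f.
have [xw xadj] := key x xS xo; have [yw yadj] := key y yS yo.
have tE u : u != w -> (tperm v w u : nat) = if (u : nat) == v then (w : nat) else u.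
  move=> uw; case: tpermP => [->|/eqP|/eqP uv _]; rewrite ?eqxx ?(negPf uw) //.
  by case: ifP => // /eqP/val_inj/eqP; rewrite (negPf uv).
rewrite !tE //.
rewrite -val_eqE /= in xw; rewrite -val_eqE /= in yw.
move: (R j x : nat) (R j y : nat) (v : nat) (w : nat) lt_wv xw yw xadj yadj.
by clear=> a b u z lt_zu az bz adj_a adj_b; case: (eqVneq a u); case: (eqVneq b u); lia.
Qed.

(** Neighbour exchanges carry [o] down to the minimum of [T], each time to the largest element of
    [T] below its current position. *)
Let N_min (T : {set 'I_p}) v w : v \in T -> w \in T ->
  {in T, forall u : 'I_p, (w <= u)%N} ->
  N T v = N T w.
Proof.
move=> vT wT min_w; have [m] := ubnP v; elim: m v vT => // m IH v vT lt_vm.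
have [<- //|neq_wv] := eqVneq w v.
have lt_wv : (w < v)%N by rewrite ltn_neqAle neq_wv min_w.
have Pw : [pred u : 'I_p | (u \in T) && (u < v)%N] w by rewrite /= wT.
case: (arg_maxnP (fun u : 'I_p => u : nat) Pw) => u /= /andP[uT lt_uv] max_u.
rewrite (@N_swap T v u) //; first by apply: IH => //; lia.
by move=> z zT; apply/negP => /andP[lt_uz lt_zv]; have := max_u z; rewrite zT lt_zv; lia.
Qed.

(** Fix the set [T] of positions that [S] occupies in the order of [j]. Then [o] is the favourite
    exactly when it sits at the minimum of [T], and by [N_min] all [#|S|] possible positions of [o]
    contribute equally. *)
Lemma sum_favourite :
  (\sum_(R : profile n p | favourite (R j) S == Some o) h R) *+ #|S| = \sum_R h R.
Proof.
rewrite (partition_big (fun R : profile n p => R j @: S) predT) //=.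
rewrite [RHS](partition_big (fun R : profile n p => R j @: S) predT) //= -sumrMnl.
apply: eq_bigr => T _.
have [w0 w0T|noT] := pickP [pred x in T]; last first.
  have RT (R : profile n p) : (R j @: S == T) = false.
    by apply/eqP => RS; have := noT (R j o); rewrite /= -RS imset_f.
  by rewrite !big_pred0 ?mul0rn // => R; rewrite RT ?andbF.
case: (arg_minnP (fun u : 'I_p => u : nat) w0T) => w wT min_w.
have min_w' : {in T, forall u : 'I_p, (w <= u)%N} by move=> u /min_w.
have [cardT|cardT] := eqVneq #|S| #|T|; last first.
  have RT (R : profile n p) : (R j @: S == T) = false.
    by apply: contraNF cardT => /eqP <-; rewrite card_imset //; apply: perm_inj.
  by rewrite !big_pred0 ?mul0rn // => R; rewrite RT ?andbF.
have -> : \sum_(R : profile n p |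
    (favourite (R j) S == Some o) && (R j @: S == T)) h R = N T w.
  apply: eq_bigl => R; rewrite andbC; case: (eqVneq (R j @: S) T) => //= RS.
  apply/eqP/eqP => [/favourite_Some[_ min_o]|Ro].
    have : w \in R j @: S by rewrite RS.
    case/imsetP => x xS def_w; apply/val_inj/eqP.
    by rewrite eqn_leq min_w' -?RS ?imset_f // def_w min_o.
  by apply/favourite_Some; split=> // x xS; rewrite Ro min_w' // -RS imset_f.
rewrite (partition_big (fun R : profile n p => R j o) (mem T)) /=.
  by rewrite cardT -sumr_const; apply: eq_bigr => v vT; rewrite -(N_min vT wT).
by move=> R /eqP <-; rewrite imset_f.
Qed.

End FavouriteUniform.

(** * The recursion and a double count *)

Section Value.
Variables (F : fieldType) (A : eqType) (p : nat) (g : nat -> F).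

(** A mean with weights [k / m] and [1 - k / m]: either position [p - m] is available and taken, or
    the search goes on. For [m < k] the values have no meaning; at [m = k] the weight is 1 and
    cancels them. *)
Fixpoint scan (k : nat) (w : nat -> F) (m : nat) : F :=
  if m is m'.+1 then
    scan k w m' + k%:R / m%:R * (g (p - m) + w m' - scan k w m')
  else 0.

(* The expected utility of agent [i] from the remaining policy [pi] when a
   uniformly random set of [size pi] of her last [m] positions is available:
   position [p - m] is available with probability [size pi / m]. *)
Fixpoint value (i : A) (pi : seq A) : nat -> F :=
  if pi is j :: pi' then
    if j == i then scan (size pi) (value i pi') else value i pi'
  else fun=> 0.

Lemma value0 i pi : value i pi 0 = 0.
Proof. by elim: pi => //= j pi IH; case: ifP. Qed.

End Value.

(** The policy consists of ordinals, while the program compares plain numbers. *)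
Lemma value_map (F : fieldType) (A B : eqType) p (g : nat -> F) (f : A -> B) i pi :
  injective f -> value p g (f i) (map f pi) = value p g i pi.
Proof.
by move=> f_inj; elim: pi => //= j pi ->; rewrite (inj_eq f_inj) size_map.
Qed.

(** A [k]-subset of [U] arises by removal once for each of the [#|U| - k] elements of [U] outside
    it. *)
Lemma sum_set_remove (V : nmodType) (T : finType) (U : {set T}) k
    (f : {set T} -> V) :
  \sum_(S : {set T} | (S \subset U) && (#|S| == k.+1)) \sum_(o in S) f (S :\ o)
  = (\sum_(S : {set T} | (S \subset U) && (#|S| == k)) f S) *+ (#|U| - k).
Proof.
rewrite (exchange_big_dep (mem U)) /=; last first.
  by move=> S o /andP[/subsetP SU _] /SU.
transitivity (\sum_(o in U)
  \sum_(S : {set T} | [&& S \subset U, #|S| == k & o \notin S]) f S).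
  apply: eq_bigr => o oU.
  rewrite (reindex_onto (fun S => o |: S) (fun S => S :\ o)) /=; last first.
    by move=> S /andP[_ oS]; rewrite setD1K.
  apply: eq_big => [S|S /andP[_ /eqP-> //]].
  rewrite subUset sub1set oU setU11 andbT /=.
  have [oS|oS] := boolP (o \in S).
    rewrite !andbF; apply/negbTE; rewrite negb_and orbC.
    by apply/orP; left; apply/eqP => /setP/(_ o); rewrite !inE eqxx oS.
  by rewrite setU1K // eqxx cardsU1 oS !andbT.
rewrite (exchange_big_dep (fun S : {set T} => (S \subset U) && (#|S| == k))) /=; last first.
  by move=> o S _ /and3P[-> ->].
rewrite -sumrMnl; apply: eq_bigr => S /andP[SU /eqP cardS].
rewrite -cardS -(cardsDS SU) -sumr_const cardS.
apply: eq_bigl => o; rewrite !inE; case: (o \in S); rewrite ?SU ?cardS ?eqxx ?andbF ?andbT //.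
Qed.

(** * The recursion yields the expected utility *)

Section ExpectedUtility.
Variables (F : realFieldType) (n p : nat) (g : 'I_p -> F) (i : 'I_n).
Implicit Types (R : profile n p) (S : {set 'I_p}) (pi : seq 'I_n).

Let relabel_bij (s : preference p) : bijective (@relabel n p s).
Proof.
by exists (relabel s^-1%g) => R; apply/ffunP => j; rewrite !ffunE mulgA ?mulVg ?mulgV mul1g.
Qed.

(** Group the profiles by the preference [s] of agent [i]; relabelling by [s] maps the profiles
    where it is the identity bijectively onto group [s]. *)
Let sum_relabel (f : profile n p -> F) :
  \sum_(R : profile n p) f R
  = \sum_(s : preference p) \sum_(R : profile n p | R i == 1%g) f (relabel s R).
Proof.
rewrite (partition_big (fun R : profile n p => R i) predT) //=.
apply: eq_bigr => s _; rewrite (reindex (relabel s)) /=; last exact/onW_bij/relabel_bij.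
by apply: eq_bigl => R; rewrite ffunE -{2}[s]mulg1 (inj_eq (mulgI s)).
Qed.

Let utility_relabel s R (pi : p.-tuple 'I_n) :
  utility g (relabel s R) i pi = utility g R i pi.
Proof.
have sT : s @: [set: 'I_p] = [set: 'I_p].
  by apply/setP => x; rewrite inE -[x](permKV s) imset_f.
rewrite /utility -{2}sT -bundle_relabel big_imset /=; last by apply: in2W; apply: perm_inj.
by apply: eq_bigr => o _; rewrite ffunE permM.
Qed.

Let D := #|[pred R : profile n p | R i == 1%g]|.

(** An unnormalised expectation. As [i] has the identity preference, each item is its own position,
    hence [g o]. *)
Let total pi S : F :=
  \sum_(R : profile n p | R i == 1%g) \sum_(o in bundle R i pi S) g o.

Let expected_utility_total (pi : p.-tuple 'I_n) :
  D%:R * expected_utility g i pi = total pi setT.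
Proof.
have pf_neq0 : p`!%:R != 0 :> F by rewrite pnatr_eq0 -lt0n fact_gt0.
(* Both sides count all profiles; the product form avoids an exponent [n - 1]. *)
have cardE : p`!%:R * D%:R = p`!%:R ^+ n :> F.
  transitivity (\sum_(R : profile n p) 1 : F); last first.
    by rewrite sumr_const card_ffun card_Sn card_ord natrX.
  by rewrite sum_relabel !sumr_const card_Sn -[RHS]mulr_natl.
rewrite /expected_utility.
transitivity (D%:R * (p`!%:R ^+ n)^-1 * \sum_R utility g R i pi).
  rewrite -mulrA; congr (_ * _); rewrite mulr_sumr; apply: eq_bigr => R _.
  by rewrite /profile_prob prodr_const card_ord exprVn.
rewrite sum_relabel.
under eq_bigr => s _ do under eq_bigr => R _ do rewrite utility_relabel.
have D_neq0 : D%:R != 0 :> F.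
  apply/eqP => D0; move/eqP: cardE; rewrite D0 mulr0 eq_sym expf_eq0.
  by rewrite (negPf pf_neq0) andbF.
have -> : \sum_(R : profile n p | R i == 1%g) utility g R i pi = total pi setT.
  by apply: eq_bigr => R /eqP Ri; apply: eq_bigr => o _; rewrite Ri perm1.
rewrite sumr_const card_Sn -[X in _ * X = _]mulr_natl -cardE.
by field; apply/andP.
Qed.

Let total_nil S : total [::] S = 0.
Proof. by rewrite /total big1 // => R _; rewrite big_set0. Qed.

Let total_self pi S o : o \in S -> {in S, forall x : 'I_p, (o <= x)%N} ->
  total (i :: pi) S = D%:R * g o + total pi (S :\ o).
Proof.
move=> oS min_o; rewrite mulr_natl -sumr_const -big_split /=.
apply: eq_bigr => R /eqP Ri; rewrite (@bundle_cons _ _ _ _ _ _ _ o).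
  rewrite eqxx big_setU1 //=; apply/negP => /(subsetP (bundle_sub _ _ _ _)).
  by rewrite !inE eqxx.
by apply/favourite_Some; split=> // x xS; rewrite Ri !perm1 min_o.
Qed.

(** By [sum_favourite], each item of [S] is taken equally often by [j], independently of the later
    picks. *)
Let total_other j pi S : j != i ->
  #|S|%:R * total (j :: pi) S = \sum_(o in S) total pi (S :\ o).
Proof.
move=> ji.
(* The condition on [i] becomes an indicator, since [sum_favourite] ranges over all profiles;
   [j != i] makes it insensitive to the order of [j]. *)
pose h o R : F :=
  if R i == 1%g then \sum_(x in bundle R i pi (S :\ o)) g x else 0.
have -> : total (j :: pi) S
    = \sum_(o in S) \sum_(R : profile n p | favourite (R j) S == Some o) h o R.
  rewrite (exchange_big_dep predT) //= /total big_mkcond /=; apply: eq_bigr => R _.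
  case: ifP => Ri; last by rewrite big1 // => o _; rewrite /h Ri.
  case fav: (favourite (R j) S) => [o|]; last first.
    by rewrite big_set0 big_pred0 // => o; rewrite andbF.
  rewrite (negPf ji) [RHS](big_pred1 o) /h ?Ri // => x /=.
  have [oS _] := (favourite_Some _ _ _).1 fav.
  by rewrite andbC (inj_eq Some_inj) eq_sym; case: eqP => // ->; rewrite oS.
rewrite mulr_natl -sumrMnl; apply: eq_bigr => o oS.
rewrite sum_favourite // => [|R R' RR' Rj]; first by rewrite /total [RHS]big_mkcond.
rewrite /h -RR' 1?eq_sym // (bundle_order (R' := R')) // => k.
by have [->|kj] := eqVneq k j; rewrite // RR'.
Qed.

Let last_positions m : {set 'I_p} := [set x : 'I_p | (p - m <= x)%N].

Let last_positionsS m (lt_mp : (m < p)%N) (q : 'I_p) : q = (p - m.+1)%N :> nat ->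
  last_positions m.+1 = q |: last_positions m /\ q \notin last_positions m.
Proof.
move=> def_q; split; last by rewrite inE; lia.
by apply/setP => x; rewrite !inE -val_eqE /= def_q; lia.
Qed.

Let card_last_positions m : (m <= p)%N -> #|last_positions m| = m.
Proof.
elim: m => [_|m IH lt_mp].
  by apply: eq_card0 => x; rewrite inE subn0 leqNgt ltn_ord.
have lt_q : (p - m.+1 < p)%N by lia.
have [-> q_notin] := last_positionsS lt_mp (q := Ordinal lt_q) erefl.
by rewrite cardsU1 q_notin IH // ltnW.
Qed.

Let gn := nth 0 [seq g k | k <- enum 'I_p].

(** The average over random available sets, cleared of denominators; the binomial makes it hold as
    [0 = 0] when there are more picks than positions. Induction on the policy, with an inner
    induction on [m] when [i] picks. *)
Let sum_total pi m : (m <= p)%N ->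
  \sum_(S : {set 'I_p} | (S \subset last_positions m) && (#|S| == size pi)) total pi S
  = D%:R * 'C(m, size pi)%:R * value p gn i pi m.
Proof.
elim: pi m => [|j pi IH] m le_mp /=.
  by rewrite mulr0 big1 // => S _; apply: total_nil.
case: eqVneq => [->|ji]; last first.
  have k_neq0 : (size pi).+1%:R != 0 :> F by rewrite pnatr_eq0.
  apply: (mulfI k_neq0); rewrite mulr_sumr.
  under eq_bigr => S /andP[_ /eqP cardS] do rewrite -cardS total_other //.
  rewrite (sum_set_remove (last_positions m) (size pi) (total pi)).
  rewrite card_last_positions // IH // -[LHS]mulr_natr.
  have := congr1 (fun k => k%:R : F) (mul_bin_left m (size pi)).
  rewrite /= !natrM => bin.
  transitivity (D%:R * value p gn i pi m * ((m - size pi)%:R * 'C(m, size pi)%:R)).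
    by ring.
  by rewrite -bin; ring.
elim: m le_mp => [|m IHm] lt_mp.
  rewrite bin0n mulr0 big_pred0 // => S; apply/negP => /andP[SU /eqP cardS].
  have := subset_leq_card SU; rewrite card_last_positions // cardS //.
set k := size pi in IH IHm *.
have lt_q : (p - m.+1 < p)%N by lia.
pose q := Ordinal lt_q; have [last_S q_notin] := last_positionsS lt_mp (q := q) erefl.
(* Split on whether [q], the best of the last [m.+1] positions, is available: if so [i] takes it,
   otherwise the inner induction hypothesis applies. *)
rewrite (bigID (fun S : {set 'I_p} => q \in S)) /=.
have -> : \sum_(S : {set 'I_p} |
    (S \subset last_positions m.+1) && (#|S| == k.+1) && (q \notin S))
    total (i :: pi) S = D%:R * 'C(m, k.+1)%:R * scan p gn k.+1 (value p gn i pi) m.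
  rewrite -IHm //; last exact: ltnW.
  apply: eq_bigl => S; rewrite last_S andbAC; congr (_ && _).
  apply/andP/idP => [[/subsetP SU qS]|SU]; last first.
    split; first exact: subset_trans SU (subsetUr _ _).
    by apply: contra q_notin => /(subsetP SU).
  by apply/subsetP => x xS; have := SU x xS; rewrite !inE; case: eqP xS qS => // -> ->.
have -> : \sum_(S : {set 'I_p} |
    (S \subset last_positions m.+1) && (#|S| == k.+1) && (q \in S))
    total (i :: pi) S = D%:R * 'C(m, k)%:R * (g q + value p gn i pi m).
  rewrite (reindex_onto (fun S => q |: S) (fun S => S :\ q)) /=; last first.
    by move=> S /andP[_ qS]; rewrite setD1K.
  rewrite (eq_bigl (fun S => (S \subset last_positions m) && (#|S| == k))); last first.
    move=> S; rewrite setU11 andbT.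
    have [qS|qS] := boolP (q \in S).
      have -> : (S \subset last_positions m) = false.
        by apply: contraNF q_notin => /subsetP; apply.
      apply/negbTE; rewrite negb_and orbC; apply/orP; left.
      by apply/eqP => /setP/(_ q); rewrite !inE eqxx qS.
    rewrite setU1K // eqxx andbT cardsU1 qS add1n eqSS last_S subUset sub1set setU11 /=.
    congr (_ && _); rewrite -subDset (setDidPl _) // disjoint_sym disjoints1 //.
  rewrite mulrDr -IH ?(ltnW lt_mp) //.
  have -> : 'C(m, k) =
      #|[set S : {set 'I_p} | (S \subset last_positions m) && (#|S| == k)]|.
    by rewrite cards_draws card_last_positions // ltnW.
  rewrite -mulrA [_ * g q]mulr_natl mulrC mulrnAl mulrC.
  rewrite -sumr_const.
  under [X in _ = X + _]eq_bigl do rewrite inE.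
  rewrite -big_split /=; apply: eq_bigr => S /andP[SU _].
  have qS : q \notin S by apply: contra q_notin => /(subsetP SU).
  rewrite (@total_self _ _ q) ?setU11 // ?setU1K // => x.
  rewrite !inE => /orP[/eqP-> //|/(subsetP SU)].
  by rewrite inE /=; lia.
have -> : g q = gn (p - m.+1)%N.
  by rewrite /gn (nth_map q) ?size_enum_ord // -[X in nth _ _ X]/(val q) nth_ord_enum.
have m_neq0 : m.+1%:R != 0 :> F by rewrite pnatr_eq0.
(* This identity turns the binomial of the sets containing [q] into the probability [k.+1 / m.+1]
   used by [scan]. *)
have bin : m.+1%:R * 'C(m, k)%:R = k.+1%:R * 'C(m.+1, k.+1)%:R :> F.
  by rewrite -!natrM -mul_bin_diag.
rewrite -/k binS natrD.
set w := value _ _ _ _ _; set v := scan _ _ _ _ _.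
transitivity (D%:R * ('C(m, k.+1)%:R * v + 'C(m, k)%:R * v) +
   D%:R * (m.+1%:R * 'C(m, k)%:R) / m.+1%:R * (gn (p - m.+1)%N + w - v)).
  by field; rewrite nat1r.
by rewrite bin binS natrD; field; rewrite nat1r.
Qed.

Lemma expected_utility_value (pi : p.-tuple 'I_n) :
  expected_utility g i pi = value p gn i pi p.
Proof.
(* With [p] picks and [p] positions the full set is the only available set. *)
have := sum_total pi (leqnn p); rewrite (big_pred1 setT) => [|S] /=; last first.
  have -> : last_positions p = setT by apply/setP => x; rewrite !inE subnn.
  rewrite subsetT size_tuple eqEcard subsetT cardsT card_ord /=.
  by have := max_card (mem S); rewrite card_ord eqn_leq => ->.
rewrite -expected_utility_total size_tuple binn mulr1; apply: mulfI.
rewrite pnatr_eq0 -lt0n; apply/card_gt0P; exists [ffun=> 1%g].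
by rewrite inE /= ffunE.
Qed.
End ExpectedUtility.

(** * Rules for execution within a time bound, and the program *)

Section Runs.
Variable F : realFieldType.
Implicit Types (s : state F) (c : prog) (P Q : state F -> Prop).

(** A total-correctness triple; [t] is only an upper bound, so that both branches of a test can
    share it. *)
Definition runs c s (t : nat) Q :=
  exists t' s', [/\ exec c s t' s', (t' <= t)%N & Q s'].

Definition block (l : seq instr) : prog := foldr (fun a => Seq (Instr a)) Skip l.

Lemma runs_block l s Q : Q (foldl (fun s a => step a s) s l) ->
  runs (block l) s (size l) Q.
Proof.
move=> Qs; exists (size l), (foldl (fun s a => step a s) s l); split=> //.
elim: l s {Qs} => [|c l IH] s /=; first exact: ExecSkip.
by rewrite -add1n; apply: ExecSeq (ExecInstr _ _) (IH _).
Qed.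

Lemma runs_seq c1 c2 s t1 t2 P Q :
  runs c1 s t1 P -> (forall s', P s' -> runs c2 s' t2 Q) ->
  runs (Seq c1 c2) s (t1 + t2) Q.
Proof.
move=> [t1' [s1 [ex1 le1 /[swap] run2 /run2[t2' [s2 [ex2 le2 Qs]]]]]].
by exists (t1' + t2')%N, s2; split; [apply: ExecSeq ex1 ex2|apply: leq_add|].
Qed.

Lemma runs_if b c1 c2 s t Q :
  (eval_test b s -> runs c1 s t Q) -> (~~ eval_test b s -> runs c2 s t Q) ->
  runs (If b c1 c2) s t.+1 Q.
Proof.
have [eb|eb] := boolP (eval_test b s).
  by move=> /(_ isT)[t' [s' [ex le Qs]]] _; exists t'.+1, s'; split=> //; apply: ExecIfTrue.
by move=> _ /(_ isT)[t' [s' [ex le Qs]]]; exists t'.+1, s'; split=> //; apply: ExecIfFalse.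
Qed.

(** The index of [I] counts completed rounds. A round costs [t] and one test; the outer successor is
    the final, failing test. *)
Lemma runs_while b c N t (I : nat -> state F -> Prop) s :
  (forall m s', I m s' -> eval_test b s' = (m < N)%N) ->
  (forall m s', (m < N)%N -> I m s' -> runs c s' t (I m.+1)) ->
  I 0 s -> runs (While b c) s (N * t.+1).+1 (I N).
Proof.
move=> Ib Ic I0.
suff H d s' : (d <= N)%N -> I (N - d)%N s' -> runs (While b c) s' (d * t.+1).+1 (I N).
  by apply: (H _ _ (leqnn N)); rewrite subnn.
elim: d s' => [|d IH] {I0}s le_dN Is.
  rewrite subn0 in Is; exists 1%N, s; split=> //.
  by apply: ExecWhileFalse; rewrite (Ib _ _ Is) ltnn.
have [t1 [s1 [ex1 le1 Is1]]] := Ic _ _ (ltac:(lia) : (N - d.+1 < N)%N) Is.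
rewrite -subSn // subSS in Is1.
have [t2 [s2 [ex2 le2 Is2]]] := IH _ (ltnW le_dN) Is1.
exists (t1 + t2).+1, s2; split=> //; last by rewrite mulSn; lia.
by apply: ExecWhileTrue ex1 ex2; rewrite (Ib _ _ Is); lia.
Qed.

End Runs.

(* Integer registers: 3 the agent [i], 4 the number [k] of picks that remain,
   5 the number [m] of positions; 6 is scratch. Field array 2 contains
   [value i pi' m] in cell [m], where [pi'] consists of the last [k] picks. Field
   registers: 1 and 2 the last overwritten and the last written cell of this
   array; 6 is never written and remains 0; the others are scratch. *)
Definition clear_cell : prog := block [:: NAdd 5 5 2; FStore 2 5 6].

Definition scan_cell : prog := block
  [:: NAdd 5 5 2; FOfNat 3 4; FOfNat 4 5; FDiv 3 3 4; NSub 6 1 5; FLoad 5 0 6;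
      FAdd 1 1 5; FSub 1 1 2; FMul 1 1 3; FAdd 2 2 1; FLoad 1 2 5; FStore 2 5 2].

Definition scan_array : prog :=
  Seq (block [:: NConst 5 0; FSub 1 1 1; FSub 2 2 2]) (While (NLt 5 1) scan_cell).

Definition add_pick : prog :=
  Seq (block [:: NAdd 4 4 2; NSub 6 1 4; NLoad 6 0 6]) (If (NEq 6 3) scan_array Skip).

Definition clear_array : prog :=
  Seq (block [:: NConst 5 0; FStore 2 5 6]) (While (NLt 5 1) clear_cell).

Definition add_picks : prog := Seq (block [:: NConst 4 0]) (While (NLt 4 1) add_pick).

Definition agent_utility : prog :=
  Seq clear_array
    (Seq add_picks (block [:: FLoad 1 2 1; FStore 1 3 1; FAdd 0 0 1; NAdd 3 3 2])).

Definition all_utilities : prog :=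
  Seq (block [:: NConst 2 1]) (While (NLt 3 0) agent_utility).

(** * Correctness and running time of the program *)

Section Correctness.
Variables (F : realFieldType) (n p : nat) (a : seq nat) (g : nat -> F).
Hypothesis size_a : size a = p.
Implicit Type s : state F.

Let u i := value p g i a p.

(** The invariant of the loop over agents; the inner loops preserve it too. *)
Let agents_done i s : Prop :=
  [/\ [/\ nreg s 0 = n, nreg s 1 = p, nreg s 2 = 1%N, nreg s 3 = i & freg s 6 = 0],
      narr s 0 =1 nth 0%N a, farr s 0 =1 g, (forall j, (j < i)%N -> farr s 1 j = u j)
    & freg s 0 = \sum_(j < i) u j].

Lemma clear_array_runs i s : agents_done i s ->
  runs clear_array s (2 + (p * 3).+1)
    (fun s' => agents_done i s' /\ forall m, (m <= p)%N -> farr s' 2 m = 0).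
Proof.
move=> done_s.
pose I m s := [/\ agents_done i s, nreg s 5 = m & forall j, (j <= m)%N -> farr s 2 j = 0].
suff H s' : I 0%N s' -> runs (While (NLt 5 1) clear_cell) s' (p * 3).+1 (I p).
  apply: (@runs_seq _ _ _ _ 2 _ (I 0%N)); last first.
    by move=> s' /H[t [s1 [ex le [done_s1 _ c0]]]]; exists t, s1.
  apply: runs_block; split=> //= j; rewrite leqn0 => /eqP->.
  by case: done_s => -[_ _ _ _ z0] _ _ _ _; rewrite /= /upd2 /upd /= z0.
apply: (@runs_while _ _ _ p 2 I)
  => [m s1 [[[_ p1 _ _ _] _ _ _ _] m1 _]|m s1 lt_mp [d1 m1 c0]].
  by rewrite /= m1 p1.
apply: runs_block; have [[_ _ one _ z0] _ _ _ _] := d1.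
split=> //=; first by rewrite /upd /= m1 one addn1.
move=> j; rewrite /upd2 /upd /= m1 one addn1 => le_j.
by case: eqP => [_|/eqP ne_j]; rewrite ?z0 // c0 // -ltnS ltn_neqAle ne_j.
Qed.

(** The array is updated in place: cells up to [m] are new, later ones old. Cell [m.+1] needs the
    old content of cell [m], already overwritten, so a register keeps it. *)
Lemma scan_array_runs i k (w : nat -> F) s :
  w 0%N = 0 -> agents_done i s -> nreg s 4 = k ->
  (forall m, (m <= p)%N -> farr s 2 m = w m) ->
  runs scan_array s (3 + (p * 13).+1)
    (fun s' => [/\ agents_done i s', nreg s' 4 = k
       & forall m, (m <= p)%N -> farr s' 2 m = scan p g k w m]).
Proof.
move=> w0 done_s k_s w_s.
pose I m s := [/\ agents_done i s /\ nreg s 4 = k, nreg s 5 = m,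
  freg s 1 = w m, freg s 2 = scan p g k w m &
  forall j, (j <= p)%N -> farr s 2 j = if (j <= m)%N then scan p g k w j else w j].
suff H s' : I 0%N s' -> runs (While (NLt 5 1) scan_cell) s' (p * 13).+1 (I p).
  apply: (@runs_seq _ _ _ _ 3 _ (I 0%N)); last first.
    move=> s' /H[t [s1 [ex le [[done_s1 k_s1] _ _ _ c]]]]; exists t, s1; split=> //.
    by split=> // m le_mp; rewrite c // le_mp.
  (* The self-subtractions set both registers to 0, which is correct because [w] and [scan] vanish
     at 0. *)
  apply: runs_block; split=> //=; rewrite /upd /= ?subrr ?w0 // => -[|j] le_j //=.
    by rewrite w_s ?w0.
  by rewrite w_s.
apply: (@runs_while _ _ _ p 12 I) => [m s1 [[[[_ p1 _ _ _] _ _ _ _] _] m1 _ _ _]|].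
  by rewrite /= m1 p1.
move=> m s1 lt_mp [[d1 k1] m1 old1 new1 c1]; apply: runs_block.
have [[_ p1 one _ _] _ g1 _ _] := d1.
have newE : scan p g k w m + (w m + g (p - m.+1)%N - scan p g k w m) * (k%:R / m.+1%:R)
    = scan p g k w m.+1 by rewrite /=; ring.
split=> //=; rewrite /upd2 /upd /= ?m1 ?one ?addn1 ?p1 ?g1 ?k1 ?old1 ?new1 //.
- by rewrite c1 // ltnn.
- move=> j le_jp; rewrite c1 //; case: (eqVneq j m.+1) => [->|ne_j]; first by rewrite leqnn.
  by rewrite [in RHS]leq_eqVlt (negPf ne_j).
Qed.

(** The policy is read backwards, as [value] recurses on its tail; the next pick has index
    [p - k.+1]. *)
Lemma add_pick_runs i k s : agents_done i s -> nreg s 4 = k -> (k < p)%N ->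
  (forall m, (m <= p)%N -> farr s 2 m = value p g i (drop (p - k) a) m) ->
  runs add_pick s (3 + (3 + (p * 13).+1).+1)
    (fun s' => [/\ agents_done i s', nreg s' 4 = k.+1
       & forall m, (m <= p)%N -> farr s' 2 m = value p g i (drop (p - k.+1) a) m]).
Proof.
move=> done_s k_s lt_kp w_s.
pose P s := [/\ agents_done i s, nreg s 4 = k.+1, nreg s 6 = nth 0%N a (p - k.+1)
   & forall m, (m <= p)%N -> farr s 2 m = value p g i (drop (p - k) a) m].
have valueE : value p g i (drop (p - k.+1) a) =
    if nth 0%N a (p - k.+1) == i then scan p g k.+1 (value p g i (drop (p - k) a))
    else value p g i (drop (p - k) a).
  rewrite (drop_nth 0%N) ?size_a /=; last by lia.
  have -> : (p - k.+1).+1 = (p - k)%N by lia.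
  by rewrite size_drop size_a subKn // ltnW.
apply: (@runs_seq _ _ _ _ 3 _ P) => [|s1 [d1 k1 a1 w1]].
  apply: runs_block; have [[_ p1 one _ _] a1 _ _ _] := done_s.
  by split=> //=; rewrite /upd /= k_s one ?p1 addn1 ?a1.
have [[_ _ _ i1 _] _ _ _ _] := d1.
rewrite valueE; apply: runs_if => /=; rewrite a1 i1; [move=> ->|move/negPf=> ->].
  exact: scan_array_runs (value0 _ _ _ _) d1 k1 w1.
by exists 0%N, s1; split=> //; apply: ExecSkip.
Qed.

Lemma agent_utility_runs i s : agents_done i s ->
  runs agent_utility s
    (2 + (p * 3).+1 + (1 + (p * (3 + (3 + (p * 13).+1).+1).+1).+1 + 4))
    (agents_done i.+1).
Proof.
move=> done_s.
pose I k s := [/\ agents_done i s, nreg s 4 = k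
  & forall m, (m <= p)%N -> farr s 2 m = value p g i (drop (p - k) a) m].
apply: runs_seq (clear_array_runs done_s) _ => s1 [d1 c1].
apply: (@runs_seq _ _ _ _ _ _ (I p)).
  apply: (@runs_seq _ _ _ _ 1 _ (I 0%N)) => [|s2 I2].
    apply: runs_block; split=> //= m le_mp.
    by rewrite subn0 -size_a drop_size /= c1.
  apply: runs_while I2 => [k s3 [[[_ p3 _ _ _] _ _ _ _] k3 _]|k s3 lt_kp [d3 k3 w3]].
    by rewrite /= k3 p3.
  exact: add_pick_runs.
move=> s2 [[[n2 p2 one2 i2 z2] a2 g2 u2 sw2] _]; rewrite subnn drop0 => w2.
apply: runs_block; split=> //=.
- by split=> //; rewrite /= /upd /= i2 one2 addn1.
- move=> j; rewrite /upd2 /upd /= i2 p2 w2 // ltnS => le_ji.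
  by case: eqP => [->//|/eqP ne_ji]; rewrite u2 // ltn_neqAle ne_ji.
- by rewrite big_ord_recr /upd /= p2 w2 // sw2.
Qed.

Lemma all_utilities_runs s : nreg s 0 = n -> nreg s 1 = p -> nreg s 3 = 0%N ->
  freg s 0 = 0 -> freg s 6 = 0 -> narr s 0 =1 nth 0%N a -> farr s 0 =1 g ->
  runs all_utilities s
   (1 + (n * (2 + (p * 3).+1 + (1 + (p * (3 + (3 + (p * 13).+1).+1).+1).+1 + 4)).+1).+1)
   (agents_done n).
Proof.
move=> n_s p_s i_s sw_s z_s a_s g_s.
apply: (@runs_seq _ _ _ _ 1 _ (agents_done 0%N)) => [|s1 d1].
  by apply: runs_block; split=> //=; rewrite big_ord0.
apply: runs_while d1 => [m s2 [[n2 _ _ i2 _] _ _ _ _]|m s2 _].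
  by rewrite /= i2 n2.
exact: agent_utility_runs.
Qed.

End Correctness.

(* One program for all inputs, with a running time polynomial in n and p; it
   leaves the expected utilities in field array 1 and the expected social
   welfare in field register 0. *)
Theorem corollary1 :
  exists (c : prog) (C d : nat),
    forall (F : realFieldType) (n p : nat) (pi : p.-tuple 'I_n)
           (g : 'I_p -> F),
    exists (t : nat) (s : state F),
      [/\ exec c (input_state pi g) t s,
          (t <= C * (n + p).+1 ^ d)%N,
          (forall i : 'I_n, farr s 1 i = expected_utility g i pi)
        & freg s 0 = expected_social_welfare g pi].
Proof.
(* Agents, picks and positions give three nested loops, hence degree 3. With [n] and [p] replaced by
   [x = n + p], the bound has leading term [13 x^3], and 20 leaves room for the rest. *)
exists all_utilities, 20%N, 3%N => F n p pi g.
have uE (i : 'I_n) :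
    value p (nth 0 [seq g k | k <- enum 'I_p]) (i : nat) [seq val j | j <- pi] p
    = expected_utility g i pi.
  by rewrite expected_utility_value -(value_map _ _ _ _ val_inj).
have size_a : size [seq val j | j <- pi] = p by rewrite size_map size_tuple.
have [//|//|//|//|//|//|//|t [s [ex le_t [_ _ _ u_s sw_s]]]] :=
  all_utilities_runs (s := input_state pi g) (n := n)
    (g := nth 0 [seq g k | k <- enum 'I_p]) size_a.
exists t, s; split=> //.
- apply: leq_trans le_t _; rewrite !expnS expn0 muln1.
  have /andP[le_n le_p] : (n <= n + p)%N && (p <= n + p)%N by rewrite leq_addr leq_addl.
  move: (n + p)%N le_n le_p => x le_n le_p.
  apply: (@leq_trans (1 + (x * (2 + (x * 3).+1 +
    (1 + (x * (3 + (3 + (x * 13).+1).+1).+1).+1 + 4)).+1).+1)).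
    by rewrite leq_add2l ltnS leq_mul //; nia.
  by nia.
- by move=> i; rewrite u_s.
- by rewrite sw_s /expected_social_welfare; apply: eq_bigr => i _; rewrite uE.
Qed.
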